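(* Let $K\subset X$ be any set, and assume that (i) the adjoint semigroup $(S_t^* )_{t\ge0}$ is injective (i.e. $S_t^*$ is injective for every $t\ge0$); (ii) $\big(\mathrm{span}\{A^jb:\ b\in K^\perp,\ 0\le j\le\ell(b)\}\big)^\perp=\{0\}$. Then for any $p_f\in X$, $p_f\ne0$, the set $\{t\ge0:\ S_t^*p_f\in K\}$ has (Lebesgue) measure $0$.
   Context: $X$ is a Hilbert space, $A:\mathcal D(A)\to X$ is an (unbounded) operator generating a $C_0$-semigroup $(S_t)_{t\ge0}$ on $X$, and $(S_t^* )_{t\ge0}$ is the adjoint semigroup. $K^\perp$ is the orthogonal complement of $K$ in $X$. For $b\in X$, $\ell(b)$ is the largest integer $j\ge0$ such that $b\in\mathcal D(A^j)$ (with $\mathcal D(A^0)=X$), and $\ell(b)=+\infty$ if $b\in\mathcal D(A^j)$ for all $j\in\mathbb N$; when $\ell(b)=+\infty$, the condition $0\le j\le\ell(b)$ means all integers $j\ge0$. *)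

(* Defs.v *)
From HB Require Import structures.
From mathcomp Require Import all_boot all_order all_algebra.
From mathcomp Require Import sesquilinear complex.
From mathcomp Require Import all_classical all_reals all_analysis.

Set Implicit Arguments.
Unset Strict Implicit.
Unset Printing Implicit Defensive.

Import Order.TTheory GRing.Theory Num.Theory.
Import numFieldNormedType.Exports.

Local Open Scope classical_set_scope.
Local Open Scope ring_scope.

(* Hilbert spaces are taken over the reals or over the complex numbers. *)
Variant scalar_kind := real_scalars | complex_scalars.

Definition scalar_field (R : realType) (k : scalar_kind) : numFieldType :=
  match k with
  | real_scalars => R
  | complex_scalars => R[i]
  end.

Definition of_real (R : realType) (k : scalar_kind) :
    {rmorphism R -> scalar_field R k} :=
  match k return {rmorphism R -> scalar_field R k} with
  | real_scalars => idfun
  | complex_scalars => real_complex R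
  end.

Definition conj_scalar (R : realType) (k : scalar_kind) :
    {rmorphism scalar_field R k -> scalar_field R k} :=
  match k return {rmorphism scalar_field R k -> scalar_field R k} with
  | real_scalars => idfun
  | complex_scalars => @Num.conj R[i]
  end.

(* The inner product is linear in its first argument. *)
HB.mixin Record isHilbert (R : realType) (k : scalar_kind) X
    & CompleteNormedModule (scalar_field R k) X := {
  inner : {dot X for conj_scalar R k} ;
  inner_norm : forall x : X, inner x x = `|x| ^+ 2
}.

#[short(type="hilbertType")]
HB.structure Definition Hilbert (R : realType) (k : scalar_kind) :=
  { X of CompleteNormedModule (scalar_field R k) X & isHilbert R k X }.

Section Hilbert.
Context {R : realType} {k : scalar_kind} {X : hilbertType R k}.
Implicit Types (B D : set X) (A T : X -> X) (S : R -> X -> X).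

Definition orthocompl B : set X :=
  [set x | forall y, B y -> inner x y = 0].

Definition lin_span B : set X :=
  [set x | exists (n : nat) (c : 'I_n -> scalar_field R k) (v : 'I_n -> X),
     (forall i, B (v i)) /\ x = \sum_(i < n) c i *: v i].

Definition is_adjoint T Tadj :=
  forall x y, inner (T x) y = inner x (Tadj y).

(* Only the operators S t with 0 <= t matter. *)
Record c0_semigroup S : Prop := {
  c0_linear : forall t, 0 <= t -> linear (S t) ;
  c0_bounded : forall t, 0 <= t -> continuous (S t) ;
  c0_id : forall x, S 0 x = x ;
  c0_add : forall s t, 0 <= s -> 0 <= t -> forall x, S (s + t) x = S s (S t x) ;
  c0_cvg : forall x, S t x @[t --> 0^'+] --> x
}.

(* An unbounded operator is a pair of a domain D and a map A whose values
   outside D are irrelevant. *)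
Record is_generator D A S : Prop := {
  generator_dom : forall x, D x <->
    exists y : X, (of_real R k t)^-1 *: (S t x - x) @[t --> 0^'+] --> y ;
  generator_val : forall x, D x ->
    (of_real R k t)^-1 *: (S t x - x) @[t --> 0^'+] --> A x
}.

(* The domain of the j-th power; on it the power itself is iter j A. *)
Fixpoint dom_pow D A (j : nat) : set X :=
  if j is i.+1 then [set x | D x /\ dom_pow D A i (A x)] else setT.

(* The domains of the powers are nested and the first one is the whole space,
   so this supremum is the largest j with b in dom_pow D A j, or +oo if there
   is none. *)
Definition ell D A (b : X) : \bar R :=
  ereal_sup [set (j%:R)%:E | j in [set j : nat | dom_pow D A j b]].

End Hilbert.

(* Main.v *)
Require Import Defs.
From HB Require Import structures.
From mathcomp Require Import all_boot all_order all_algebra.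
From mathcomp Require Import sesquilinear.
From mathcomp Require Import all_classical all_reals all_analysis.

Set Implicit Arguments.
Unset Strict Implicit.
Unset Printing Implicit Defensive.

Import Order.TTheory GRing.Theory Num.Theory.
Import numFieldNormedType.Exports.

Local Open Scope classical_set_scope.
Local Open Scope ring_scope.

(** The idea is to differentiate the orbit along the bad set of times
E = {t >= 0 : S_t^* pf in K}. For b in the orthogonal complement of K, the
function t |-> <S_t b, pf> = <b, S_t^* pf> vanishes on E. If it vanishes at
times of E that decrease to t, and b is in the domain of A, then its right
derivative at t, which is <S_t (A b), pf>, vanishes too.

To iterate this, one needs a subset C of E each of whose points is a limit from
the right of points of C itself, so that a zero on C yields a zero of the
derivative on all of C, as often as the domains of the powers of A allow. Take
for C the points of E every right neighbourhood of which meets E in a set that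
is not negligible ([right_condensation]). The rest of E is negligible
([negligible_right_condensationC]), which gives at once that C accumulates on
itself from the right ([right_condensation_no_right_gap]) and that E is
negligible as soon as C is empty. Limits are taken from the right because the
right difference quotients of an orbit at t are the images under S_t of those
at 0, which the generator controls.

If C had a point t, then <A^j b, S_t^* pf> = <S_t (A^j b), pf> = 0 for all b
and j considered in the span hypothesis ([orbit_orthogonal_generator] is the
induction step); hence S_t^* pf = 0 = S_t^* 0, and pf = 0 by injectivity. *)

(** * Right condensation points of a set of reals *)

Section MeasureOnTheLine.
Context {R : realType}.
Local Notation leb := (@lebesgue_measure R).
Implicit Types E : set R.

Lemma negligible_bigcup_countable (I : countType) (F : I -> set R) :
  (forall i, leb.-negligible (F i)) -> leb.-negligible (\bigcup_i F i).
Proof.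
move=> Fn.
pose G n := if unpickle n is Some i then F i else set0.
apply: (@negligibleS _ _ _ leb (\bigcup_n G n)).
  by move=> t [i _ Fit]; exists (pickle i) => //; rewrite /G pickleK.
apply: negligible_bigcup => n; rewrite /G.
by case: unpickle => [i|]; [exact: Fn|exact: negligible_set0].
Qed.

Lemma negligible_subset1 E : is_subset1 E -> leb.-negligible E.
Proof.
move=> E1; have [->|/set0P[a Ea]] := eqVneq E set0.
  exact: negligible_set0.
apply: (@negligibleS _ _ _ leb [set a]) => [t Et|]; first exact: E1.
by apply/negligibleP; [exact: measurable_set1|exact: lebesgue_measure_set1].
Qed.

Definition right_condensation E : set R :=
  [set t | E t /\ forall e, 0 < e -> ~ leb.-negligible (E `&` `]t, t + e[)].

(** A point t of E that is not a right condensation point has a rational r > t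
such that E meets ]t, r[ in a negligible set. For fixed r, the set B r of all
such t is an interval ending at r; it is covered by the ]q, r[ with q rational
in B r, each of which meets E in a negligible set, and by at most one more
point, its minimum. *)
Lemma negligible_right_condensationC E :
  leb.-negligible (E `\` right_condensation E).
Proof.
pose B (r : rat) : set R :=
  [set t | t < ratr r /\ leb.-negligible (E `&` `]t, ratr r[)].
apply: (@negligibleS _ _ _ leb (\bigcup_r (E `&` B r))).
  move=> t [Et nCt]; apply: contrapT => nB; apply: nCt; split => // e e0 Ee.
  have /rat_in_itvoo[r] : t < t + e by rewrite ltrDl.
  rewrite in_itv /= => /andP[tr rte]; apply: nB; exists r => //; split => //.
  split => //; apply: negligibleS Ee => s [Es]; rewrite /= !in_itv /=.
  by move=> /andP[ts sr]; rewrite ts (lt_trans sr).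
apply: negligible_bigcup_countable => r.
pose G (q : rat) : set R :=
  [set t | B r (ratr q) /\ (E `&` `]ratr q, ratr r[) t].
pose U : set R := \bigcup_(q in [set q | B r (ratr q)]) `]ratr q, ratr r[%classic.
apply: (@negligibleS _ _ _ leb ((B r `\` U) `|` \bigcup_q G q)).
  move=> t [Et Bt].
  have [[q [Bq qt]]|noq] := pselect (exists q, B r (ratr q) /\ ratr q < t).
    right; exists q => //; split => //; split => //=.
    by rewrite in_itv /= qt; case: Bt.
  left; split => // -[q Bq]; rewrite /= in_itv /= => /andP[qt _].
  by apply: noq; exists q.
apply: negligibleU; last first.
  apply: negligible_bigcup_countable => q.
  have [[? Bq]|nBq] := pselect (B r (ratr q)).
    by apply: negligibleS Bq => t [].
  by apply: (negligibleS (mu := leb) _ (negligible_set0 leb)) => t [].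
(* A rational between two points of B r is in B r, so only the lower of the two
   can lie outside U. *)
have noltB s t : B r s -> B r t -> ~ U t -> ~ s < t.
  move=> [sr Bs] [tr Bt] nt /rat_in_itvoo[q]; rewrite in_itv /= => /andP[sq qt].
  apply: nt; exists q; last by rewrite /= in_itv /= qt.
  split; first exact: lt_trans qt tr.
  apply: negligibleS Bs => u [Eu]; rewrite /= !in_itv /= => /andP[qu ur].
  by rewrite (lt_trans sq qu).
apply: negligible_subset1 => s t [Bs ns] [Bt nt].
by case: (ltgtP s t) => // ?; [case: (noltB s t)|case: (noltB t s)].
Qed.

(** Otherwise E would meet ]t, t + e[ only in points that are not right
condensation points, hence in a negligible set. *)
Lemma right_condensation_no_right_gap E t e :
  right_condensation E t -> 0 < e ->
  exists2 h, 0 < h < e & right_condensation E (t + h).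
Proof.
move=> [Et Ct] e0; apply: contrapT => noh; apply: (Ct _ e0).
apply: (negligibleS (mu := leb) _ (negligible_right_condensationC E)) => s [Es].
rewrite /= in_itv /= => /andP[ts ste]; split => // Cs.
by apply: noh; exists (s - t); rewrite ?subrKC ?subr_gt0 ?ts ?ltrBlDl.
Qed.

End MeasureOnTheLine.

(** * Inner products *)

Section InnerProduct.
Context {R : realType} {k : scalar_kind} {X : hilbertType R k}.
Implicit Types (x y z : X) (B : set X).

(** Pythagoras for x = (x - c y) + c y, where c y is the orthogonal projection
of x on the line of y; this covers real and complex scalars alike. *)
Lemma inner_Cauchy_Schwarz x y : `|inner x y| <= `|x| * `|y|.
Proof.
have [->|y0] := eqVneq y 0; first by rewrite linear0r !normr0 mulr0.
have ny0 : 0 < `|y| by rewrite normr_gt0.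
pose c := inner x y / `|y| ^+ 2.
have xcy : inner (x - c *: y) (c *: y) = 0.
  rewrite linearZr_LR /= linearBl /= linearZl_LR /= inner_norm.
  by rewrite divfK ?subrr ?mulr0 // expf_neq0 // gt_eqF.
have Pyth : `|x| ^+ 2 = `|x - c *: y| ^+ 2 + `|c *: y| ^+ 2.
  by rewrite -!inner_norm -(hnormDd xcy) subrK.
have: `|c *: y| ^+ 2 <= `|x| ^+ 2 by rewrite Pyth lerDr exprn_ge0.
rewrite ler_pXn2r ?nnegrE // normrZ /c normrM normfV normrX normr_id.
rewrite expr2 invfM mulrA divfK ?gt_eqF //.
by rewrite ler_pdivrMr.
Qed.

Lemma inner_eq0C x y : inner x y = 0 -> inner y x = 0.
Proof.
move=> xy; have -> : inner y x = (-1) ^+ false * conj_scalar R k (inner x y).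
  exact: hermC.
by rewrite xy rmorph0 mulr0.
Qed.

(** Orthogonality to y passes to the limit even when it is known only for
frequently many t, that is, for some t in each set of the filter. *)
Lemma inner_eq0_limit {T : Type} (F : set_system T) {FF : Filter F}
    (u : T -> X) x y :
  u @ F --> x -> (forall P : set T, F P -> exists2 t, P t & inner (u t) y = 0) ->
  inner x y = 0.
Proof.
move=> ux uy; apply/eqP/negP => /negP xy0.
have e0 : 0 < `|inner x y| / (`|y| + 1).
  by rewrite divr_gt0 ?normr_gt0 // ltr_wpDl.
move/cvgrPdist_lt : ux => /(_ _ e0)/uy[t xut ut0].
have xy_le : `|inner x y| <= `|x - u t| * `|y|.
  by rewrite -[inner x y]subr0 -ut0 -linearBl; exact: inner_Cauchy_Schwarz.
have xy_gt : `|x - u t| * (`|y| + 1) < `|inner x y|.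
  by rewrite -ltr_pdivlMr // ltr_wpDl.
have : `|x - u t| * `|y| <= `|x - u t| * (`|y| + 1).
  by rewrite ler_wpM2l // lerDl.
by move=> /(le_trans xy_le)/le_lt_trans/(_ xy_gt); rewrite ltxx.
Qed.

Lemma orthocompl_lin_span B x : orthocompl B x -> orthocompl (lin_span B) x.
Proof.
move=> xB y [n [c [v [Bv ->]]]]; rewrite linear_sumr big1 // => i _.
by rewrite linearZr_LR /= xB // mulr0.
Qed.

Lemma adjoint0 (T Tadj : X -> X) : is_adjoint T Tadj -> Tadj 0 = 0.
Proof.
move=> /(_ (Tadj 0) 0); rewrite linear0r inner_norm => /esym/eqP.
by rewrite expf_eq0 normr_eq0 => /eqP.
Qed.

End InnerProduct.

(** * Domains of the powers of an operator *)

Section PowersOfOperator.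
Context {R : realType} {k : scalar_kind} {X : hilbertType R k}.
Variables (D : set X) (A : X -> X).

Lemma dom_pow_leq i j b : (i <= j)%N -> dom_pow D A j b -> dom_pow D A i b.
Proof.
elim: i j b => [|i IH] [|j] b //= ij [Db Aj]; split => //; exact: IH Aj.
Qed.

Lemma dom_pow_iter j b : dom_pow D A j.+1 b -> D (iter j A b).
Proof. by elim: j b => [|j IH] b [] // Db /IH; rewrite -iterSr. Qed.

Lemma le_ell_dom_pow j b : ((j%:R)%:E <= ell D A b)%E -> dom_pow D A j b.
Proof.
case: j => [//|j] jb; apply: contrapT => njb; move: jb; apply/negP.
rewrite -ltNge; apply: (@le_lt_trans _ _ (j%:R)%:E); last first.
  by rewrite lte_fin ltr_nat.
apply: ge_ereal_sup => _ [i bi <-]; rewrite lee_fin ler_nat leqNgt.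
by apply/negP => ji; apply: njb; exact: dom_pow_leq bi.
Qed.

End PowersOfOperator.

(** * Differentiating orbits of the semigroup *)

Section Semigroup.
Context {R : realType} {k : scalar_kind} {X : hilbertType R k}.
Variables (D : set X) (A : X -> X) (S : R -> X -> X).
Hypotheses (S_c0 : c0_semigroup S) (A_gen : is_generator D A S).

(** As S (t + h) x - S t x = S t (S h x - x), the continuous operator S t carries
the difference quotient at 0 to the one at t. *)
Lemma orbit_right_derivative t x : 0 <= t -> D x ->
  (of_real R k h)^-1 *: (S (t + h) x - S t x) @[h --> 0^'+] --> S t (A x).
Proof.
move=> t0 Dx.
have St : S t ((of_real R k h)^-1 *: (S h x - x)) @[h --> 0^'+] --> S t (A x).
  apply: continuous_cvg; first exact: (c0_bounded S_c0 t0).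
  exact: (generator_val A_gen Dx).
apply: cvg_trans St; apply: near_eq_cvg; near=> h.
have h0 : 0 <= h by near: h; apply: filterS (nbhs_right_gt 0) => h /ltW.
have lS := c0_linear S_c0 t0.
have SZ (c : scalar_field R k) (v : X) : S t (c *: v) = c *: S t v.
  exact: (scalable_linear lS).
have SB (u v : X) : S t (u - v) = S t u - S t v.
  exact: (zmod_morphism_linear lS).
by rewrite SZ SB -(c0_add S_c0).
Unshelve. all: by end_near. Qed.

(** The difference quotients of the orbit of x at t, taken between two points of
C, are orthogonal to p, and they occur for arbitrarily small increments. *)
Lemma orbit_orthogonal_generator (C : set R) x p :
  (forall t, C t -> 0 <= t) ->
  (forall t e, C t -> 0 < e -> exists2 h, 0 < h < e & C (t + h)) ->
  D x -> (forall t, C t -> inner (S t x) p = 0) ->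
  forall t, C t -> inner (S t (A x)) p = 0.
Proof.
move=> C_ge0 C_acc Dx Cx t Ct.
apply: (inner_eq0_limit (orbit_right_derivative (C_ge0 _ Ct) Dx)).
move=> P [e /= e0 eP]; have [h /andP[h0 he] Cth] := C_acc t e Ct e0.
exists h; first by apply: eP => //=; rewrite sub0r normrN gtr0_norm.
by rewrite linearZl_LR /= linearBl /= !Cx // subrr mulr0.
Qed.

End Semigroup.

Theorem proposition1p1 (R : realType) (k : scalar_kind) (X : hilbertType R k)
  (D : set X) (A : X -> X) (S Sadj : R -> X -> X)
  (S_c0 : c0_semigroup S)
  (A_gen : is_generator D A S)
  (S_adj : forall t, 0 <= t -> is_adjoint (S t) (Sadj t))
  (K : set X)
  (Sadj_inj : forall t, 0 <= t -> injective (Sadj t))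
  (K_span : orthocompl (lin_span
     [set x | exists (b : X) (j : nat),
        [/\ orthocompl K b, ((j%:R)%:E <= ell D A b)%E & x = iter j A b]])
     = [set 0]) :
  forall pf : X, pf <> 0 ->
    (@lebesgue_measure R).-negligible [set t : R | 0 <= t /\ K (Sadj t pf)].
Proof.
move=> pf pf0; set E := (X in _.-negligible X).
pose C := right_condensation E.
have C_ge0 t : C t -> 0 <= t by move=> [[]].
have orth b j t : orthocompl K b -> dom_pow D A j b -> C t ->
    inner (S t (iter j A b)) pf = 0.
  move=> Kb; elim: j t => [|j IH] t Djb Ct /=.
    by rewrite S_adj ?C_ge0 //; apply: Kb; case: Ct => [[]].
  have Dj : D (iter j A b) by exact: dom_pow_iter Djb.
  apply: (orbit_orthogonal_generator S_c0 A_gen C_ge0 _ Dj _ Ct).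
    by move=> s e; exact: right_condensation_no_right_gap.
  by move=> s; apply: IH; exact: dom_pow_leq Djb.
have C0 t : ~ C t.
  move=> Ct; have t0 := C_ge0 t Ct; apply: pf0; apply: (Sadj_inj t t0).
  rewrite (adjoint0 (S_adj t t0)).
  suff : [set 0] (Sadj t pf) by [].
  rewrite -K_span; apply: orthocompl_lin_span => _ [b [j [Kb jb ->]]].
  apply: inner_eq0C; rewrite -S_adj //; apply: orth => //.
  exact: le_ell_dom_pow jb.
apply: negligibleS (negligible_right_condensationC E) => t Et.
by split => //; exact: C0.
Qed.
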